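(* Let $n\ge1$ and $\mu,\nu,\lambda\in\mathsf{Par}_n$ such that $|\mu|+|\nu|+|\lambda|$ is even and, for every $(A,A',B,B',C,C')\in\mathcal{G}_n$, $$0\leq \sum_{i\in A} \mu_i - \sum_{i\in A'} \mu_i + \sum_{j\in B} \nu_j - \sum_{j\in B'} \nu_j + \sum_{k\in C} \lambda_k - \sum_{k\in C'} \lambda_k .$$ Suppose at least one of $\mu,\nu,\lambda$ is a single row (a partition of the form $(p,0,\dots,0)$) or a single column (a partition of the form $(1,\dots,1,0,\dots,0)$). Then $N_{\mu,\nu,\lambda}>0$.
   Context: $\mathsf{Par}_n=\{(\lambda_1,\dots,\lambda_n)\in\mathbb{Z}_{\ge0}^n:\lambda_1\ge\cdots\ge\lambda_n\}$, $|\lambda|=\sum_i\lambda_i$, and $[n]=\{1,\dots,n\}$. $c^{\gamma}_{\alpha,\beta}$ denotes the Littlewood–Richardson coefficient (partitions identified up to trailing zeros). The Newell–Littlewood number is $N_{\mu,\nu,\lambda}=\sum_{\alpha,\beta,\gamma} c^{\mu}_{\alpha,\beta}c^{\nu}_{\alpha,\gamma}c^{\lambda}_{\beta,\gamma}$ over all partitions $\alpha,\beta,\gamma$. For a finite set $I=\{i_1<\cdots<i_d\}\subseteq\mathbb{Z}_{>0}$, $\tau(I)=(i_d-d\ge\cdots\ge i_2-2\ge i_1-1)$. $\mathcal{G}_n$ is the set of tuples $(A,A',B,B',C,C')$ of subsets of $[n]$ such that: (I) $A\cap A'=B\cap B'=C\cap C'=\emptyset$; (II) $|A|=|B'|+|C'|$,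 $|B|=|A'|+|C'|$, $|C|=|A'|+|B'|$; (III) there exist $A_1,A_2,B_1,B_2,C_1,C_2\subseteq[n]$ with (1) $|A_1|=|A_2|=|A'|$, $|B_1|=|B_2|=|B'|$, $|C_1|=|C_2|=|C'|$; (2) $c^{\tau(A')}_{\tau(A_1),\tau(A_2)}, c^{\tau(B')}_{\tau(B_1),\tau(B_2)}, c^{\tau(C')}_{\tau(C_1),\tau(C_2)}>0$; (3) $c^{\tau(A)}_{\tau(B_1),\tau(C_2)}, c^{\tau(B)}_{\tau(C_1),\tau(A_2)}, c^{\tau(C)}_{\tau(A_1),\tau(B_2)}>0$. *)

(* Defs.v *)
From mathcomp Require Import all_boot all_order all_algebra.

Set Implicit Arguments.
Unset Strict Implicit.
Unset Printing Implicit Defensive.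

(* A partition is a weakly decreasing sequence of naturals; trailing zeros are
   allowed, and the i-th part (counted from 0) is [nth 0 s i].  Elements of
   Par_n are the weakly decreasing n-tuples. *)
Definition is_part (s : seq nat) : bool := sorted geq s.

Section LittlewoodRichardson.

(* A filling of the skew shape ga / al with entries in {1, ..., size be} is a
   function on the bounding rectangle of ga, with value 0 exactly at the cells
   outside ga / al. *)
Variables (al be ga : seq nat).
Let cell : finType := ('I_(size ga) * 'I_(head 0 ga))%type.
Variable T : {ffun cell -> 'I_(size be).+1}.

Definition skew_filling : bool :=
  [forall c : cell, (0 < T c) == (nth 0 al c.1 <= c.2 < nth 0 ga c.1)].

Definition row_weak : bool :=
  [forall c : cell, forall d : cell,
    [&& c.1 == d.1, c.2 <= d.2, 0 < T c & 0 < T d] ==> (T c <= T d)].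

Definition col_strict : bool :=
  [forall c : cell, forall d : cell,
    [&& c.2 == d.2, c.1 < d.1, 0 < T c & 0 < T d] ==> (T c < T d)].

Definition has_content : bool :=
  [forall k : 'I_(size be), #|[set c | T c == k.+1 :> nat]| == nth 0 be k].

(* The reading word runs through the rows from top to bottom, each one from
   right to left. *)
Definition read_before (d c : cell) : bool :=
  (d.1 < c.1) || ((d.1 == c.1) && (c.2 <= d.2)).

Definition ballot : bool :=
  [forall c : cell, forall k : 'I_(size be), (0 < k) ==>
    (#|[set d | read_before d c && (T d == k.+1 :> nat)]|
       <= #|[set d | read_before d c && (T d == k :> nat)]|)].

Definition LR_tableau : bool :=
  [&& skew_filling, row_weak, col_strict, has_content & ballot].

End LittlewoodRichardson.

Definition part_sub (al ga : seq nat) : bool :=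
  [forall i : 'I_(size al), nth 0 al i <= nth 0 ga i].

(* c^ga_(al, be): the number of Littlewood-Richardson tableaux of shape
   ga / al and content be. *)
Definition LRcoef (al be ga : seq nat) : nat :=
  if part_sub al ga then #|[set T | @LR_tableau al be ga T]| else 0.

Lemma part_subP al ga :
  reflect (forall i, nth 0 al i <= nth 0 ga i) (part_sub al ga).
Proof.
apply: (iffP forallP) => [H i|H i]; last exact: H.
by case: (ltnP i (size al)) => [lt_i|/(nth_default 0) -> //]; exact: (H (Ordinal lt_i)).
Qed.

Lemma is_part_nth s i j : is_part s -> i <= j -> nth 0 s j <= nth 0 s i.
Proof.
move=> ps le_ij; case: (ltnP j (size s)) => [lt_j|/(nth_default 0) -> //].
have tr : transitive geq by move=> y x z /= xy yz; exact: leq_trans yz xy.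
by apply: (sorted_leq_nth tr leqnn 0 ps) => //; rewrite inE // (leq_ltn_trans le_ij).
Qed.

Lemma LR_tableau_le_row al be ga T : @LR_tableau al be ga T ->
  forall c, T c <= c.1.+1.
Proof.
case/and5P=> _ /forallP Trow _ _ /forallP Tbal [i j].
have [m] := ubnP (nat_of_ord i); elim: m => // m IH in i j * => le_im /=.
rewrite leqNgt; apply/negP => lt_iT.
case E : (nat_of_ord (T (i, j))) lt_iT => [//|k]; rewrite ltnS => lt_ik.
have k_be : k < size be by rewrite -ltnS -E ltn_ord.
have /implyP/(_ (leq_ltn_trans (leq0n i) lt_ik)) :=
  forallP (Tbal (i, j)) (Ordinal k_be).
have p0 : 0 < #|[set d | read_before d (i, j) && (T d == k.+1 :> nat)]|.
  by apply/card_gt0P; exists (i, j); rewrite inE /read_before /= eqxx leqnn orbT E eqxx.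
move=> le_kk; have {p0 le_kk} := leq_trans p0 le_kk.
case/card_gt0P=> -[i' j']; rewrite inE /read_before /= => /andP[bef /eqP Tk].
case/orP: bef => [lt_i|].
  have := IH i' j' (leq_trans lt_i le_im); rewrite /= Tk => le_k.
  by have := leq_trans lt_ik le_k; rewrite ltnS leqNgt lt_i.
case/andP=> /eqP ei le_j; rewrite {i'}ei in Tk.
have /implyP := forallP (Trow (i, j)) (i, j').
rewrite /= eqxx le_j E Tk (leq_ltn_trans (leq0n i) lt_ik) /= => /(_ isT).
by rewrite ltnn.
Qed.

(* Hence in the sum defining the Newell-Littlewood number only the al and be
   contained in mu and the ga contained in nu contribute. *)
Lemma LRcoef_gt0_sub al be ga : is_part ga -> 0 < LRcoef al be ga ->
  part_sub al ga && part_sub be ga.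
Proof.
move=> pga; rewrite /LRcoef; case: ifP => //= _ /card_gt0P[T]; rewrite inE => LT.
have le_row := LR_tableau_le_row LT.
case/and5P: LT => /forallP Tsh _ /forallP Tcol /forallP Tcnt _.
apply/forallP=> k; rewrite -(eqP (Tcnt k)).
have inj2 : {in [set c | T c == k.+1 :> nat] &, injective snd}.
  move=> [i j] [i' j']; rewrite !inE /= => /eqP Tc /eqP Td ej; rewrite -{}ej in Td *.
  case: (ltngtP i i') => [lt_i|lt_i|/val_inj-> //].
    by have /implyP := forallP (Tcol (i, j)) (i', j); rewrite /= eqxx lt_i Tc Td ltnn => /(_ isT).
  by have /implyP := forallP (Tcol (i', j)) (i, j); rewrite /= eqxx lt_i Tc Td ltnn => /(_ isT).
rewrite -(card_in_imset inj2) -[leqRHS]card_ord.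
have -> : #|'I_(nth 0 ga k)| = size (iota 0 (nth 0 ga k)) by rewrite card_ord size_iota.
rewrite cardE -(size_map val); apply: uniq_leq_size.
  by rewrite (map_inj_uniq val_inj) enum_uniq.
move=> x /mapP[j]; rewrite mem_enum => /imsetP[[i j']]; rewrite inE => /eqP Tc /= -> -> {x j}.
rewrite mem_iota /= add0n.
have := Tsh (i, j'); rewrite Tc /= => /eqP/esym/andP[_ lt_j].
apply: leq_trans lt_j (is_part_nth pga _).
by have := le_row (i, j'); rewrite Tc.
Qed.

Definition bounded_part (m b : nat) : pred (m.-tuple 'I_b.+1) :=
  fun t => is_part (map val t).

(* N_(mu, nu, la).  By LRcoef_gt0_sub, nonzero terms require al, be to be
   contained in mu and ga in nu, so that, padding with zeros, it is enough to
   let al, be have size mu parts of value at most |mu|, and likewise for ga. *)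
Definition NL (mu nu la : seq nat) : nat :=
  \sum_(al : (size mu).-tuple 'I_(sumn mu).+1 | bounded_part al)
  \sum_(be : (size mu).-tuple 'I_(sumn mu).+1 | bounded_part be)
  \sum_(ga : (size nu).-tuple 'I_(sumn nu).+1 | bounded_part ga)
    LRcoef (map val al) (map val be) mu
    * LRcoef (map val al) (map val ga) nu
    * LRcoef (map val be) (map val ga) la.

(* [n] is represented by 'I_n, the ordinal i standing for i + 1; [enum I] is
   increasing, and the subtraction below is never truncated. *)
Definition tau (n : nat) (I : {set 'I_n}) : seq nat :=
  let s := [seq (val i).+1 | i <- enum I] in
  rev [seq nth 0 s k - k.+1 | k <- iota 0 (size s)].

Definition in_G (n : nat) (A A' B B' C C' : {set 'I_n}) : Prop :=
  [/\ [/\ A :&: A' = set0, B :&: B' = set0 & C :&: C' = set0],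
      [/\ #|A| = #|B'| + #|C'|, #|B| = #|A'| + #|C'| & #|C| = #|A'| + #|B'|]
    & exists A1 A2 B1 B2 C1 C2 : {set 'I_n},
      [/\ [/\ #|A1| = #|A'|, #|A2| = #|A'|, #|B1| = #|B'| & #|B2| = #|B'|],
          #|C1| = #|C'| /\ #|C2| = #|C'|,
          [/\ 0 < LRcoef (tau A1) (tau A2) (tau A'),
              0 < LRcoef (tau B1) (tau B2) (tau B')
            & 0 < LRcoef (tau C1) (tau C2) (tau C')]
        & [/\ 0 < LRcoef (tau B1) (tau C2) (tau A),
              0 < LRcoef (tau C1) (tau A2) (tau B)
            & 0 < LRcoef (tau A1) (tau B2) (tau C)]]].

Definition sum_on (n : nat) (I : {set 'I_n}) (s : n.-tuple nat) : int :=
  (\sum_(i in I) (tnth s i)%:Z)%R.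

Definition single_row (n : nat) (s : n.-tuple nat) : Prop :=
  exists p, s = p :: nseq n.-1 0 :> seq nat.

Definition single_column (n : nat) (s : n.-tuple nat) : Prop :=
  exists2 k, k <= n & s = nseq k 1 ++ nseq (n - k) 0 :> seq nat.

(* Main.v *)
Require Import Defs.
From mathcomp Require Import all_boot all_order all_algebra.
From mathcomp Require Import zify.

(* If [la] is a row (column) of size [p], then [N_(mu, nu, la) > 0] if and only if
   there is a partition [al] of size [(|mu| + |nu| - p) / 2] such that [mu / al]
   and [nu / al] are horizontal (vertical) strips.  Such [al] are the partitions
   between two explicit bounds [lo] and [hi], so one exists as soon as [lo <= hi]
   and the required size lies between [|lo|] and [|hi|].  Each of these conditions
   is the inequality of an explicit element of [G_n], all of whose
   Littlewood-Richardson coefficients are instances of the Pieri rule.  Since the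
   hypotheses are invariant under cyclic shifts of [mu, nu, la], one may take the
   row or column to be [la]. *)

Set Implicit Arguments.
Unset Strict Implicit.
Unset Printing Implicit Defensive.

(** A Littlewood-Richardson coefficient is here a number of tableaux, so each positivity claim calls
    for an explicit tableau, and exchanging the two lower partitions is a real step. Both Pieri
    rules therefore come in two forms. If the row or column is the content, the strip is filled in
    the only possible way; if it is the inner shape, the entries have to be arranged so that the
    content is the other partition. Describing a tableau by its row counts makes all its conditions
    linear.

    The inequalities that are selected come from [2 * max(x, y) = x + y + |x - y|] and
    [2 * min(x, y) = x + y - |x - y|]: they turn the sizes of [lo] and [hi] into sums of
    [|mu_i - nu_i|]. This is why the index sets are built by sorting the indices according to the
    sign of [mu_i - nu_i]. *)

(** * Tableaux given by their row counts *)

Lemma sum_ord_between (h a b : nat) : b <= h ->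
  \sum_(j < h) (a <= j < b) = b - a.
Proof.
move=> le_bh; elim: h b le_bh => [|h IH] b le_bh.
  by rewrite big_ord0; lia.
rewrite big_ord_recr /=; case: (ltnP h b) => [lt_hb|le_b].
  have -> : \sum_(j < h) (a <= j < b) = \sum_(j < h) (a <= j < h).
    by apply: eq_bigr => j _; have := ltn_ord j; lia.
  by rewrite IH //; lia.
by rewrite IH //; lia.
Qed.

(** Cutting at row [m] lets one count serve both the content, with [m = r], and the ballot
    condition, which looks at initial rows. *)
Lemma card_cells_between (r h m : nat) (f g : nat -> nat) : m <= r ->
  (forall i, f i <= g i) -> (forall i, g i <= h) ->
  #|[set c : 'I_r * 'I_h | (c.1 < m) && (f c.1 <= c.2 < g c.1)]|
    + \sum_(i < m) f i = \sum_(i < m) g i.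
Proof.
move=> le_mr le_fg le_gh; rewrite cardsE -sum1_card.
rewrite (eq_bigl (fun c : 'I_r * 'I_h => (c.1 < m) && (f c.1 <= c.2 < g c.1))) //.
rewrite -(pair_big_dep (fun i : 'I_r => i < m)
  (fun i (j : 'I_h) => f i <= j < g i) (fun _ _ => 1)) /=.
rewrite (eq_bigr (fun i : 'I_r => g i - f i)); last first.
  by move=> i _; rewrite -[RHS](sum_ord_between _ (le_gh i)) big_mkcond.
rewrite (big_ord_narrow le_mr (F := fun i : 'I_r => g i - f i)) -big_split.
by apply: eq_bigr => i _ /=; rewrite subnK.
Qed.

(* [P i k] is the number of cells of row [i] that lie in [al] or have an entry at
   most [k]. *)
Lemma LRcoef_gt0 (al be ga : seq nat) (P : nat -> nat -> nat) :
  is_part ga ->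
  (forall i, P i 0 = nth 0 al i) ->
  (forall i, P i (size be) = nth 0 ga i) ->
  (forall i k, P i k <= P i k.+1) ->
  (forall i k, P i.+1 k.+1 <= P i k) ->
  (forall k, k < size be ->
     \sum_(i < size ga) P i k.+1 = \sum_(i < size ga) P i k + nth 0 be k) ->
  (forall m k, \sum_(i < m.+1) P i k.+2 + \sum_(i < m) P i k
     <= \sum_(i < m.+1) P i k.+1 + \sum_(i < m) P i k.+1) ->
  0 < LRcoef al be ga.
Proof.
move=> pga P0 Pn Pmono Pcol Pcont Pbal.
have Ple i k l : k <= l -> P i k <= P i l.
  move=> le_kl; rewrite -(subnK le_kl); elim: (l - k) => // d IH.
  exact: leq_trans IH (Pmono _ _).
have Pdec i i' k : i < i' -> P i' k.+1 <= P i k.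
  elim: i' => // i' IH; rewrite ltnS leq_eqVlt => /orP[/eqP <- //|/IH H].
  exact: leq_trans (leq_trans (Pcol _ _) (Pmono _ _)) H.
have al_le i : nth 0 al i <= nth 0 ga i by rewrite -P0 -Pn Ple.
(* The entry in column [j] of row [i] is the least [k] with [j < P i k]. It is 0 on [al] because
   [P i 0] is the row of [al]; outside [ga] the value 0 is imposed. *)
pose t i j := if j < nth 0 ga i
  then find (fun k => j < P i k) (iota 0 (size be).+1) else 0.
have tP i j k : k <= size be -> j < nth 0 ga i -> (t i j <= k) = (j < P i k).
  move=> le_k lt_j; rewrite /t lt_j.
  have has_k : has (fun k => j < P i k) (iota 0 (size be).+1).
    apply/hasP; exists (size be); first by rewrite mem_iota /= add0n ltnS.
    by rewrite Pn.
  apply/idP/idP => [le_f|lt_P].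
    have := nth_find 0 has_k; rewrite nth_iota;
      last by rewrite -ltnS in le_k; exact: leq_ltn_trans le_k.
    by rewrite add0n => H; apply: leq_trans H (Ple _ _ _ le_f).
  rewrite leqNgt; apply/negP => lt_k; have := before_find 0 lt_k.
  by rewrite nth_iota ?ltnS // add0n lt_P.
have t_out i j : nth 0 ga i <= j -> t i j = 0 by rewrite /t ltnNge => ->.
have t_le i j : t i j <= size be.
  by case: (ltnP j (nth 0 ga i)) => H; [rewrite tP // Pn | rewrite t_out].
have t0 i j : (0 < t i j) = (nth 0 al i <= j < nth 0 ga i).
  case: (ltnP j (nth 0 ga i)) => H; last by rewrite t_out // andbF.
  by rewrite andbT [0 < _]ltnNge tP // P0 -leqNgt.
have tS i j k : k < size be -> (t i j == k.+1) = (P i k <= j < P i k.+1).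
  move=> lt_k; case: (ltnP j (nth 0 ga i)) => H.
    by rewrite eqn_leq tP // [k < _]ltnNge (tP _ _ _ (ltnW lt_k)) // -leqNgt andbC.
  rewrite t_out //; have := Ple i _ _ lt_k; rewrite Pn; lia.
have P_head i k : k <= size be -> P i k <= head 0 ga.
  move=> le_k; apply: leq_trans (Ple _ _ _ le_k) _; rewrite Pn -nth0.
  exact: is_part_nth.
rewrite /LRcoef ifT; last by apply/part_subP.
pose T : {ffun 'I_(size ga) * 'I_(head 0 ga) -> 'I_(size be).+1} :=
  [ffun c : 'I_(size ga) * 'I_(head 0 ga) => inord (t c.1 c.2)].
have TE c : T c = t c.1 c.2 :> nat by rewrite ffunE inordK // ltnS.
have card_T m k : k < size be -> m <= size ga ->
    #|[set c : 'I_(size ga) * 'I_(head 0 ga) | (c.1 < m) && (T c == k.+1 :> nat)]|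
      + \sum_(i < m) P i k
    = \sum_(i < m) P i k.+1.
  move=> lt_k le_m.
  rewrite -(@card_cells_between (size ga) (head 0 ga) m (P^~ k) (P^~ k.+1)) //;
    last by move=> i; exact: P_head.
  by congr (_ + _); apply: eq_card => c; rewrite !inE TE tS.
apply/card_gt0P; exists T; rewrite inE; apply/and5P; split.
- by apply/forallP=> c; rewrite TE t0.
- apply/forallP=> -[i j]; apply/forallP=> -[i' j']; apply/implyP.
  rewrite !TE /= => /and4P[/eqP <- le_j t1 t2].
  have lt_j' : j' < nth 0 ga i by move: t2; rewrite t0 => /andP[].
  rewrite tP //; last exact: leq_ltn_trans lt_j'.
  by apply: leq_ltn_trans le_j _; rewrite -tP.
- apply/forallP=> -[i j]; apply/forallP=> -[i' j']; apply/implyP.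
  rewrite !TE /= => /and4P[/eqP <- lt_i t1 t2].
  have lt_j : j < nth 0 ga i by move: t1; rewrite t0 => /andP[].
  have lt_j' : j < nth 0 ga i' by move: t2; rewrite t0 => /andP[].
  case E : (t i' j) t2 => [|k] // _; have lt_k : k < size be by rewrite -E.
  rewrite ltnS (tP _ _ _ (ltnW lt_k)) //.
  by apply: leq_trans (Pdec _ _ k lt_i); rewrite -(tP _ _ _ lt_k) // E.
- apply/forallP=> k; rewrite -(eqn_add2r (\sum_(i < size ga) P i k)).
  rewrite [X in _ == X]addnC -Pcont // -(card_T _ _ (ltn_ord k) (leqnn _)) eqn_add2r.
  by apply/eqP/eq_card => c; rewrite !inE ltn_ord.
apply/forallP=> -[i j]; apply/forallP=> -[[|k] lt_k] //=.
(* A row is read from right to left, so the worst moment in row [i] comes after all its entries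
   [k + 2] and before its entries [k + 1]. It suffices to compare the former in rows up to [i] with
   the latter in rows before [i]. *)
apply: (@leq_trans #|[set c : 'I_(size ga) * 'I_(head 0 ga) | (c.1 < i.+1) && (T c == k.+2 :> nat)]|).
  apply/subset_leq_card/subsetP=> d; rewrite !inE /read_before /= => /andP[H ->].
  by rewrite andbT ltnS leq_eqVlt; case/orP: H => [->|/andP[/eqP -> _]]; rewrite ?eqxx ?orbT.
apply: (@leq_trans #|[set c : 'I_(size ga) * 'I_(head 0 ga) | (c.1 < i) && (T c == k.+1 :> nat)]|); last first.
  by apply/subset_leq_card/subsetP=> d; rewrite !inE /read_before /= => /andP[-> ->].
have := card_T _ _ lt_k (ltn_ord i); have := card_T _ _ (ltnW lt_k) (ltnW (ltn_ord i)).
by have := Pbal i k; lia.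
Qed.

(** * The Pieri rules, with the row or column as content or as inner shape *)

Lemma sumn_nth (s : seq nat) (m : nat) : size s <= m ->
  sumn s = \sum_(i < m) nth 0 s i.
Proof.
move=> le_m; rewrite sumnE (big_nth 0) big_mkord (big_ord_widen _ _ le_m).
rewrite big_mkcond; apply: eq_bigr => i _; case: ltnP => //.
by move/(nth_default 0) ->.
Qed.

Lemma sum_tail_rec (n : nat) (f : nat -> nat) (k : nat) :
  (forall i, n <= i -> f i = 0) ->
  \sum_(k <= j < n) f j = f k + \sum_(k.+1 <= j < n) f j.
Proof.
move=> f0; case: (ltnP k n) => [lt_k|le_n]; first by rewrite big_ltn.
by rewrite !big_geq ?f0 // ltnW.
Qed.

Lemma LRcoef_row_right (al be ga : seq nat) :
  is_part ga -> size al <= size ga ->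
  (forall i, nth 0 al i <= nth 0 ga i) ->
  (forall i, nth 0 ga i.+1 <= nth 0 al i) ->
  (forall k, nth 0 be k.+1 = 0) ->
  sumn al + nth 0 be 0 = sumn ga ->
  0 < LRcoef al be ga.
Proof.
move=> pga le_s le_al le_ga be0; rewrite (sumn_nth le_s) (sumn_nth (leqnn _)) => Es.
pose P i k := if k is 0 then nth 0 al i else nth 0 ga i.
have le1 i : nth 0 ga i.+1 <= nth 0 ga i by apply: is_part_nth.
apply: (@LRcoef_gt0 _ _ _ P) => //.
(* If [be] is empty there is no letter to fill the strip with; the equal sums then force [al] and
   [ga] to agree in every row. *)
- move=> i; case: (be) Es => //=; rewrite addn0 => /eqP.
  have := @leqif_sum _ (fun _ : 'I_(size ga) => true) _ _ _
    (fun i _ => leqif_eq (le_al (nat_of_ord i))).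
  move=> [_ ->] /forallP H; case: (ltnP i (size ga)) => [lt_i|le_i].
    by have /eqP := H (Ordinal lt_i).
  by rewrite !nth_default // (leq_trans le_s).
- by move=> i [|k] /=.
- by move=> i [|k] /=.
- by move=> [|k] _ /=; rewrite ?be0 ?addn0.
- move=> m [|k] //=; rewrite leq_add2l leq_sum //.
Qed.

(** In the tableau built here the letter [k + 1] occurs only in rows [k] and [k + 1]. Having [be_k]
    copies of it means [ga_k - E k + E k.+1 = be_k], which makes [E] the tail sums of [ga - be]. *)
Lemma LRcoef_row_left (al be ga : seq nat) :
  is_part ga -> size be <= size ga ->
  (forall i, nth 0 be i <= nth 0 ga i) ->
  (forall i, nth 0 ga i.+1 <= nth 0 be i) ->
  (forall k, nth 0 al k.+1 = 0) ->
  sumn be + nth 0 al 0 = sumn ga ->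
  0 < LRcoef al be ga.
Proof.
move=> pga le_s le_be le_ga al0; rewrite (sumn_nth le_s) (sumn_nth (leqnn _)) => Es.
have le1 i : nth 0 ga i.+1 <= nth 0 ga i by apply: is_part_nth.
pose n := size ga; pose e i := nth 0 ga i - nth 0 be i.
pose E k := \sum_(k <= j < n) e j; pose G m := \sum_(i < m) nth 0 ga i.
have Erec k : E k = e k + E k.+1.
  by apply: sum_tail_rec => i le_i; rewrite /e nth_default.
have E0 : E 0 = nth 0 al 0.
  rewrite /E big_mkord; apply/eqP; rewrite -(eqn_add2l (\sum_(i < n) nth 0 be i)) Es.
  by rewrite -big_split; apply/eqP/eq_bigr => i _; exact: subnKC.
(* Downward induction: [E k.+1 <= ga_(k+1) <= be_k] absorbs the subtraction in
   [E k = ga_k - be_k + E k.+1]. *)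
have E_le k : E k <= nth 0 ga k.
  have [d] := ubnP (n - k); elim: d k => // d IH k le_d.
  case: (leqP n k) => [le_n|lt_k]; first by rewrite /E big_geq.
  have := IH k.+1; have := le_be k; have := le_ga k; rewrite (Erec k) /e; lia.
have GS m : G m.+1 = G m + nth 0 ga m by rewrite /G big_ord_recr.
(* Row [i] (counted from 0) of the tableau contains [E i] entries [i], or cells of
   [al] if [i = 0], followed by entries [i + 1]. *)
pose P i k := if k < i then 0 else if k == i then E i else nth 0 ga i.
pose R m k := \sum_(i < m) P i k.
have RS m k : R m.+1 k = R m k + P m k by rewrite /R big_ord_recr.
have R1 m k : m <= k -> R m k = G m.
  elim: m => [|m IH] le_m; first by rewrite /R /G !big_ord0.
  by rewrite RS GS IH 1?ltnW // /P; do !case: ifP; lia.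
have R2 m k : k < m -> R m k = G k + E k.
  elim: m => [|m IH] // le_m; rewrite RS; case: (ltnP k m) => lt_k.
    by rewrite IH // /P lt_k addn0.
  have -> : m = k by lia.
  by rewrite R1 // /P ltnn eqxx.
apply: (@LRcoef_gt0 _ _ _ P) => //.
- by move=> [|i]; rewrite /P /= ?E0 ?al0.
(* Below row [size be] the shape is empty, as [ga_i <= be_(i-1) = 0]; in row [size be] itself [E] is
   the whole row of [ga]. *)
- move=> i; rewrite /P; case: ltnP => [lt_i|le_i].
    have := le_ga i.-1; rewrite prednK ?(nth_default 0 (s := be)); lia.
  case: eqP => // Ei; have := Erec i; have := E_le i.+1; have := le_ga i.
  by rewrite /e (nth_default 0 (s := be)) -?Ei //; lia.
- by move=> i k; rewrite /P; have := E_le i; do !case: ifP; lia.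
- by move=> i k; rewrite /P; have := E_le i; have := Erec i; have := le1 i; do !case: ifP; lia.
- move=> k lt_k; change (R n k.+1 = R n k + nth 0 be k).
  have lt_kn : k < n by apply: leq_trans le_s.
  rewrite (R2 _ _ lt_kn); have := Erec k; have := GS k; have := le_be k; rewrite /e.
  case: (ltnP k.+1 n) => [lt|ge]; first by rewrite R2 //; lia.
  have En : n = k.+1 by apply/eqP; rewrite eqn_leq ge lt_kn.
  have -> : E k.+1 = 0 by rewrite /E big_geq.
  by rewrite R1 // En; lia.
move=> m k; change (R m.+1 k.+2 + R m k <= R m.+1 k.+1 + R m k.+1).
have := Erec k; have := Erec k.+1; have := GS k; have := GS k.+1.
have := le_be k; have := le_be k.+1; have := le_ga k; rewrite /e.
case: (ltngtP m k.+1) => [lt|gt|->].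
- by rewrite !R1 //; lia.
- by rewrite !R2 //; lia.
- by rewrite (R1 k.+2) // (R2 k.+2) // (R2 k.+1) // (R1 k.+1) //; lia.
Qed.

Lemma LRcoef_col_right (b : nat) (al be ga : seq nat) :
  is_part al -> is_part ga -> size al <= size ga ->
  (forall i, nth 0 al i <= nth 0 ga i <= (nth 0 al i).+1) ->
  b <= size be -> (forall k, nth 0 be k = (k < b)) ->
  sumn al + b = sumn ga ->
  0 < LRcoef al be ga.
Proof.
move=> pal pga le_s le_al le_b beE; rewrite (sumn_nth le_s) (sumn_nth (leqnn _)) => Es.
have le1 i : nth 0 ga i.+1 <= nth 0 ga i by apply: is_part_nth.
have le2 i : nth 0 al i.+1 <= nth 0 al i by apply: is_part_nth.
pose n := size ga; pose e i := nth 0 ga i - nth 0 al i.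
pose g m := \sum_(i < m) e i; pose S m := \sum_(i < m) nth 0 al i.
have gS m : g m.+1 = g m + e m by rewrite /g big_ord_recr.
have SS m : S m.+1 = S m + nth 0 al m by rewrite /S big_ord_recr.
have gn : g n = b.
  apply/eqP; rewrite -(eqn_add2l (\sum_(i < n) nth 0 al i)) Es -big_split.
  by apply/eqP/eq_bigr => i _; apply: subnKC; case/andP: (le_al i).
have g_le m : g m <= b.
  have g_mono k : g k <= g k.+1 by rewrite gS leq_addr.
  have e0 k : n <= k -> e k = 0 by move=> le_k; rewrite /e nth_default.
  have g_n k : g (n + k) = b.
    by elim: k => [|k IH]; rewrite ?addn0 // addnS gS IH e0 ?leq_addr ?addn0.
  case: (leqP n m) => [le_n|lt_m]; first by rewrite -(subnKC le_n) g_n.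
  rewrite -gn -(subnKC (ltnW lt_m)); elim: (n - m) => [|k IH]; first by rewrite addn0.
  by rewrite addnS; apply: leq_trans IH (g_mono _).
(* The entries [1], ..., [b] are placed from top to bottom. *)
pose P i k := nth 0 al i + (if g i.+1 <= k then e i else 0).
pose R m k := \sum_(i < m) P i k.
(* The strip cells of the first [m] rows carry the entries from 1 to [g m], each once. *)
have RE m k : R m k = S m + minn k (g m).
  elim: m => [|m IH]; first by rewrite /R /S /g !big_ord0 minn0.
  rewrite [LHS]big_ord_recr -/(R m k) IH SS gS /P gS; have := le_al m; rewrite /= /e.
  by case: ifP; lia.
apply: (@LRcoef_gt0 _ _ _ P) => //.
- by move=> i; rewrite /P gS; case: ifP; lia.
- by move=> i; rewrite /P (leq_trans (g_le _)) // subnKC //; case/andP: (le_al i).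
- by move=> i k; rewrite /P; do !case: ifP; lia.
- move=> i k; rewrite /P !gS /e; have := le_al i; have := le_al i.+1.
  by have := le1 i; have := le2 i; do !case: ifP; lia.
- by move=> k lt_k; change (R n k.+1 = R n k + nth 0 be k); rewrite !RE gn beE; lia.
move=> m k; change (R m.+1 k.+2 + R m k <= R m.+1 k.+1 + R m k.+1); rewrite !RE; have := le_al m.
by have := gS m; rewrite /e; lia.
Qed.

(** The rows above [k + E k] are those whose first cell, if any, lies in [al] or has an entry at
    most [k]. This depth is [b] for [k = 0] and grows by [1 - e k], so the first column receives a
    further letter exactly when [e k = 0]. *)
Lemma LRcoef_col_left (b : nat) (al be ga : seq nat) :
  is_part be -> is_part ga -> size be = size ga ->
  (forall i, nth 0 be i <= nth 0 ga i <= (nth 0 be i).+1) ->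
  (forall k, nth 0 al k = (k < b)) ->
  sumn be + b = sumn ga ->
  0 < LRcoef al be ga.
Proof.
move=> pbe pga eq_s le_be alE.
have le_s : size be <= size ga by rewrite eq_s.
rewrite (sumn_nth le_s) (sumn_nth (leqnn _)) => Es.
have le1 i : nth 0 ga i.+1 <= nth 0 ga i by apply: is_part_nth.
have le2 i : nth 0 be i.+1 <= nth 0 be i by apply: is_part_nth.
pose n := size ga; pose e i := nth 0 ga i - nth 0 be i.
pose E k := \sum_(k <= j < n) e j; pose G m := \sum_(i < m) nth 0 ga i.
have e0 k : n <= k -> e k = 0 by move=> le_k; rewrite /e nth_default.
have Erec k : E k = e k + E k.+1 by apply: sum_tail_rec.
have E0 : E 0 = b.
  rewrite /E big_mkord; apply/eqP; rewrite -(eqn_add2l (\sum_(i < n) nth 0 be i)) Es.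
  by rewrite -big_split; apply/eqP/eq_bigr => i _; apply: subnKC; case/andP: (le_be i).
have E_le k : E k <= n - k.
  have [d] := ubnP (n - k); elim: d k => // d IH k le_d.
  case: (leqP n k) => [le_n|lt_k]; first by rewrite /E big_geq.
  have := IH k.+1; have := le_be k; rewrite (Erec k) /e; lia.
have GS m : G m.+1 = G m + nth 0 ga m by rewrite /G big_ord_recr.
(* The first-column cells claimed by [P] exist: [ga_i = 0] would give [E i = 0], and since [E] drops
   by at most 1 at each step, [E k <= i - k]. *)
have E_pos k i : k <= i -> i < k + E k -> 0 < nth 0 ga i.
  move=> le_k lt_i; rewrite lt0n; apply/eqP => ga0.
  have Ei : E i = 0.
    rewrite /E big_nat big1 // => j /andP[le_j _]; apply/eqP; rewrite subn_eq0.
    by have := is_part_nth pga le_j; rewrite ga0 leqn0 => /eqP ->.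
  suff : E k <= i - k + E i by lia.
  rewrite -{1}(subKn le_k); elim: (i - k) (leq_subr k i) => [|d IH] le_d.
    by rewrite subn0.
  have := IH (ltnW le_d); rewrite (Erec (i - d.+1)).
  have -> : (i - d.+1).+1 = i - d by lia.
  by have := le_be (i - d.+1); rewrite /e; lia.
(* Row [i] contains [i + 1] in all columns but the first; below the [b] cells of
   [al], the first column lists the [k + 1] with [e k = 0]. *)
pose P i k := if k <= i then (i < k + E k : nat) else nth 0 ga i.
pose R m k := \sum_(i < m) P i k.
have RS m k : R m.+1 k = R m k + P m k by rewrite /R big_ord_recr.
have R1 m k : m <= k -> R m k = G m.
  elim: m => [|m IH] le_m; first by rewrite /R /G !big_ord0.
  by rewrite RS GS IH 1?ltnW // /P; do !case: ifP; lia.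
have R2 m k : k <= m -> R m k = G k + minn (m - k) (E k).
  elim: m => [|m IH] le_m.
    move: le_m; rewrite leqn0 => /eqP ->.
    by rewrite R1 // subnn min0n addn0.
  case: (ltnP m k) => lt_k.
    have -> : k = m.+1 by lia.
    by rewrite R1 // subnn min0n addn0.
  by rewrite RS IH // /P lt_k; lia.
apply: (@LRcoef_gt0 _ _ _ P) => //.
- by move=> i; rewrite /P /= add0n E0 alE.
- move=> i; rewrite /P eq_s; case: (leqP (size ga) i) => // le_i.
  have -> : E (size ga) = 0 by rewrite /E big_geq.
  by rewrite nth_default // addn0 ltnNge le_i.
- move=> i k; rewrite /P; have := Erec k; have := le_be k; rewrite /e.
  by have := E_pos k i; do !case: ifP; lia.
- move=> i k; rewrite /P; have := Erec k; have := le_be k; rewrite /e.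
  by have := le1 i; do !case: ifP; lia.
- move=> k lt_k; change (R n k.+1 = R n k + nth 0 be k).
  rewrite eq_s in lt_k; rewrite !R2 //; last exact: ltnW.
  have := E_le k; have := E_le k.+1; have := Erec k; have := GS k; have := le_be k.
  by rewrite /e /n; lia.
move=> m k; change (R m.+1 k.+2 + R m k <= R m.+1 k.+1 + R m k.+1).
have := Erec k; have := Erec k.+1; have := GS k; have := GS k.+1.
have := le_be k; have := le_be k.+1; have := le2 k; have := le1 k; rewrite /e.
case: (leqP m k) => [lt|gt].
- by rewrite !R1 //; lia.
- by rewrite !R2 //; lia.
Qed.

(** * Partitions of prescribed size between two bounds *)

(** Greedy choice: the missing [s - |lo|] units are spent from row 0 on. The result is [hi], then at
    most one intermediate row, then [lo], so it decreases because both bounds do. *)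
Lemma interpolate_part (n s : nat) (lo hi : nat -> nat) :
  (forall i, lo i <= hi i) ->
  (forall i, lo i.+1 <= lo i) -> (forall i, hi i.+1 <= hi i) ->
  \sum_(i < n) lo i <= s -> s <= \sum_(i < n) hi i ->
  exists x : nat -> nat,
    [/\ forall i, lo i <= x i <= hi i, forall i, x i.+1 <= x i
      & \sum_(i < n) x i = s].
Proof.
move=> le_lh lo_dec hi_dec le_s s_le.
pose D m := \sum_(i < m) (hi i - lo i); pose t := s - \sum_(i < n) lo i.
pose x i := lo i + minn (hi i - lo i) (t - D i).
have DS m : D m.+1 = D m + (hi m - lo m) by rewrite /D big_ord_recr.
have xE m : \sum_(i < m) x i = \sum_(i < m) lo i + minn (D m) t.
  elim: m => [|m IH]; first by rewrite /D !big_ord0 min0n.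
  by rewrite !big_ord_recr IH DS /x /=; lia.
exists x; split.
- by move=> i; rewrite /x; have := le_lh i; lia.
- move=> i; rewrite /x; have := le_lh i; have := le_lh i.+1; have := lo_dec i.
  by have := hi_dec i; have := DS i; lia.
have Dn : D n + \sum_(i < n) lo i = \sum_(i < n) hi i.
  by rewrite /D -big_split; apply: eq_bigr => i _; exact: subnK.
by rewrite xE /t; lia.
Qed.

(** * Positivity of the Newell-Littlewood number from a single triple *)

Lemma is_partP (s : seq nat) :
  (forall i, nth 0 s i.+1 <= nth 0 s i) -> is_part s.
Proof. by move=> H; apply/(sortedP 0) => i _; exact: H. Qed.

Lemma nth_le_sumn (s : seq nat) (i : nat) : nth 0 s i <= sumn s.
Proof.
elim: s i => [|x s IH] [|i] //=; first exact: leq_addr.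
by apply: leq_trans (IH i) (leq_addl _ _).
Qed.

Lemma bounded_part_lift (m b : nat) (s : seq nat) :
  size s = m -> is_part s -> (forall i, nth 0 s i <= b) ->
  exists2 t : m.-tuple 'I_b.+1, bounded_part t & map val t = s.
Proof.
move=> sz ps le_b.
have sz' : size [seq inord x : 'I_b.+1 | x <- s] == m by rewrite size_map sz.
suff E : map val (Tuple sz') = s by exists (Tuple sz') => //; rewrite /bounded_part E.
rewrite /= -map_comp -[RHS]map_id; apply/eq_in_map => x /(nthP 0)[i _ <-] /=.
by rewrite inordK // ltnS.
Qed.

Lemma NL_gt0 (mu nu la al be ga : seq nat) :
  is_part mu -> is_part nu -> is_part al -> is_part be -> is_part ga ->
  size al = size mu -> size be = size mu -> size ga = size nu ->
  0 < LRcoef al be mu -> 0 < LRcoef al ga nu -> 0 < LRcoef be ga la ->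
  0 < NL mu nu la.
Proof.
move=> pmu pnu pal pbe pga sal sbe sga c1 c2 c3.
have /andP[/part_subP al_mu /part_subP be_mu] := LRcoef_gt0_sub pmu c1.
have /andP[_ /part_subP ga_nu] := LRcoef_gt0_sub pnu c2.
have [ta pta Ea] := bounded_part_lift sal pal
  (fun i => leq_trans (al_mu i) (nth_le_sumn mu i)).
have [tb ptb Eb] := bounded_part_lift sbe pbe
  (fun i => leq_trans (be_mu i) (nth_le_sumn mu i)).
have [tg ptg Eg] := bounded_part_lift sga pga
  (fun i => leq_trans (ga_nu i) (nth_le_sumn nu i)).
rewrite /NL (bigD1 ta) //= (bigD1 tb) //= (bigD1 tg) //= Ea Eb Eg.
by rewrite !addn_gt0 !muln_gt0 c1 c2 c3.
Qed.

(* [tau I] read off the increasing list of the elements of [I], counted from 0. *)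
Definition seq_tau (s : seq nat) : seq nat :=
  rev [seq nth 0 s k - k | k <- iota 0 (size s)].

(** * Index sets as increasing lists, and their partitions *)

Lemma size_seq_tau s : size (seq_tau s) = size s.
Proof. by rewrite size_rev size_map size_iota. Qed.

Lemma tau_seq_tau (n : nat) (I : {set 'I_n}) : tau I = seq_tau (map val (enum I)).
Proof.
rewrite /tau /seq_tau !size_map; congr rev; apply/eq_in_map => k.
rewrite mem_iota add0n /= => lt_k.
have i0 : 'I_n by case: (enum I) lt_k.
by rewrite !(nth_map i0) // subSS.
Qed.

Definition seq_set (n : nat) (s : seq nat) : {set 'I_n} := [set i | val i \in s].

Lemma sorted_enum_set (n : nat) (I : {set 'I_n}) : sorted ltn (map val (enum I)).
Proof.
rewrite /enum_mem -enumT /= sorted_map; apply: sorted_filter.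
  by move=> y x z; exact: ltn_trans.
by rewrite -(@sorted_map _ _ val ltn) val_enum_ord iota_ltn_sorted.
Qed.

Definition increasing_below (n : nat) (s : seq nat) : bool :=
  sorted ltn s && all (fun x => x < n) s.

Lemma enum_seq_set (n : nat) (s : seq nat) : increasing_below n s ->
  map val (enum (seq_set n s)) = s.
Proof.
case/andP=> ss /allP lt_s; apply: (irr_sorted_eq ltn_trans ltnn) => //.
  exact: sorted_enum_set.
move=> x; apply/mapP/idP => [[i]|x_s]; first by rewrite mem_enum inE => H ->.
by exists (Ordinal (lt_s _ x_s)); rewrite // mem_enum inE.
Qed.

Lemma tau_seq_set (n : nat) (s : seq nat) : increasing_below n s ->
  tau (seq_set n s) = seq_tau s.
Proof. by move=> Hs; rewrite tau_seq_tau enum_seq_set. Qed.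

Lemma card_seq_set (n : nat) (s : seq nat) : increasing_below n s ->
  #|seq_set n s| = size s.
Proof. by move=> Hs; rewrite cardE -(size_map val) enum_seq_set. Qed.

Lemma sum_on_seq_set (n : nat) (s : seq nat) (mu : n.-tuple nat) :
  increasing_below n s ->
  sum_on (seq_set n s) mu = (\sum_(x <- s) nth 0 mu x)%N%:Z%R.
Proof.
move=> Hs; rewrite -[in RHS](enum_seq_set Hs) big_map big_enum /= /sum_on.
rewrite -[RHS]intz -[RHS]/(_%:R)%R GRing.natr_sum; apply: eq_bigr => i _.
by rewrite (tnth_nth 0) natz.
Qed.

Lemma seq_set_disjoint (n : nat) (s t : seq nat) : ~~ has (mem s) t ->
  seq_set n s :&: seq_set n t = set0.
Proof.
move/hasPn => H; apply/setP => i; rewrite !inE.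
by apply/negbTE/negP => /andP[i_s /H /=]; rewrite i_s.
Qed.

Lemma nth_sorted_ltn (s : seq nat) (k : nat) : sorted ltn s ->
  k < size s -> nth 0 s 0 + k <= nth 0 s k.
Proof.
move=> ss; elim: k => [|k IH] lt_k; first by rewrite addn0.
rewrite addnS; apply: leq_ltn_trans (IH (ltnW lt_k)) _.
by have /(sortedP 0)/(_ k lt_k) := ss.
Qed.

Lemma is_part_seq_tau (s : seq nat) : sorted ltn s -> is_part (seq_tau s).
Proof.
move=> ss; rewrite /is_part /seq_tau rev_sorted; apply/(sortedP 0) => k.
rewrite size_map size_iota => lt_k.
have lt_k' := ltnW lt_k; rewrite !(nth_map 0) ?size_iota // !nth_iota // !add0n /=.
by have /(sortedP 0)/(_ k lt_k) := ss; lia.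
Qed.

(** Intervals starting at 0 encode zero partitions, and those starting at 1 encode columns; most
    auxiliary index sets below are of these two kinds. *)
Lemma seq_tau_iota (a d : nat) : seq_tau (iota a d) = nseq d a.
Proof.
rewrite /seq_tau size_iota -[RHS](revK) rev_nseq; congr rev.
apply: (@eq_from_nth _ 0); first by rewrite size_map size_iota size_nseq.
move=> i; rewrite size_map size_iota => lt_i.
by rewrite (nth_map 0) ?size_iota // !nth_iota // nth_nseq lt_i add0n addnK.
Qed.

Lemma seq_tau1 (x : nat) : seq_tau [:: x] = [:: x].
Proof. by rewrite /seq_tau /= subn0. Qed.

Lemma seq_tau_rcons (s : seq nat) (x : nat) :
  seq_tau (rcons s x) = x - size s :: seq_tau s.
Proof.
rewrite /seq_tau size_rcons -addn1 iotaD map_cat rev_cat /= add0n.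
rewrite nth_rcons ltnn eqxx; congr (_ :: rev _); apply/eq_in_map => k.
by rewrite mem_iota /= add0n nth_rcons => ->.
Qed.

Lemma seq_tau_map_predn (s : seq nat) :
  seq_tau (map predn s) = map predn (seq_tau s).
Proof.
rewrite /seq_tau map_rev size_map -map_comp; congr rev; apply/eq_in_map => k.
by rewrite mem_iota add0n => lt_k; rewrite /= (nth_map 0) //; lia.
Qed.

(** Adjoining the index 0 raises the rank of every other index by one, which costs one unit in every
    part. *)
Lemma seq_tau_cons0 (s : seq nat) :
  seq_tau (0 :: s) = rcons (seq_tau (map predn s)) 0.
Proof.
rewrite /seq_tau /= rev_cons size_map; congr (rcons (rev _) _).
rewrite -[1]/(1 + 0) iotaDl -map_comp; apply/eq_in_map => k.
by rewrite mem_iota add0n => lt_k; rewrite /= add1n (nth_map 0) //= add0n; lia.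
Qed.

Lemma seq_tau_gt0 (s : seq nat) : sorted ltn s -> all (leq 1) s ->
  all (leq 1) (seq_tau s).
Proof.
move=> ss /(all_nthP 0) s1; rewrite all_rev; apply/(all_nthP 0) => k.
rewrite size_map size_iota => lt_k; rewrite (nth_map 0) ?size_iota // nth_iota // add0n.
by have := nth_sorted_ltn ss lt_k; have := s1 0 (leq_ltn_trans (leq0n _) lt_k); lia.
Qed.

Lemma sumn_map_predn (s : seq nat) : all (leq 1) s -> sumn (map predn s) + size s = sumn s.
Proof. by elim: s => [|x s IH] //= /andP[x1 /IH]; lia. Qed.

Lemma increasing_below_iota (n a d : nat) : a + d <= n -> increasing_below n (iota a d).
Proof.
move=> le_n; rewrite /increasing_below iota_ltn_sorted; apply/allP => x.
by rewrite mem_iota; lia.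
Qed.

Lemma increasing_below_filter (n : nat) (p : pred nat) (s : seq nat) :
  increasing_below n s -> increasing_below n (filter p s).
Proof.
case/andP=> ss al; apply/andP; split.
  by apply: sorted_filter ss => y x z; exact: ltn_trans.
by apply/allP => x; rewrite mem_filter => /andP[_]; apply: (allP al).
Qed.

Lemma increasing_below_rcons (n m : nat) (s : seq nat) : m < n ->
  increasing_below m s -> increasing_below n (rcons s m).
Proof.
move=> lt_m /andP[ss al]; apply/andP; split.
  case: s ss al => //= x s px /andP[lt_x al]; rewrite rcons_path px /=.
  by have := mem_last x s; rewrite inE => /orP[/eqP -> //|/(allP al)].
rewrite all_rcons lt_m; apply/allP => x /(allP al); lia.
Qed.

Lemma increasing_below_cons0 (n : nat) (s : seq nat) : 0 < n ->
  all (leq 1) s -> increasing_below n s -> increasing_below n (0 :: s).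
Proof.
move=> n0 s1 /andP[ss al]; apply/andP; split; last by rewrite /= n0.
by case: s s1 ss {al} => //= x s /andP[-> _].
Qed.

Lemma increasing_below_predn (n : nat) (s : seq nat) :
  all (leq 1) s -> increasing_below n s -> increasing_below n (map predn s).
Proof.
move=> s1 /andP[ss al]; apply/andP; split; last first.
  by rewrite all_map; apply/allP => x /(allP al) /=; lia.
apply: (homo_sorted_in _ s1 ss) => x y; rewrite !unfold_in /=; lia.
Qed.

(** * The Pieri coefficients attached to the chosen index sets *)

Lemma LRcoef_zero_right (al : seq nat) (d : nat) : is_part al ->
  0 < LRcoef al (nseq d 0) al.
Proof.
move=> pal; apply: LRcoef_row_right => // [i|k|]; rewrite ?nth_nseq ?if_same ?addn0 //.
exact: is_part_nth.
Qed.

Lemma LRcoef_zero_left (be : seq nat) (d : nat) : is_part be ->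
  0 < LRcoef (nseq d 0) be be.
Proof.
move=> pbe; apply: LRcoef_row_left => // [i|k|]; rewrite ?nth_nseq ?if_same ?addn0 //.
exact: is_part_nth.
Qed.

Lemma LRcoef_zeros (x y z : nat) : x <= z ->
  0 < LRcoef (nseq x 0) (nseq y 0) (nseq z 0).
Proof.
move=> le_xz; have n0 d i : nth 0 (nseq d 0) i = 0 by rewrite nth_nseq if_same.
apply: LRcoef_row_right; rewrite ?size_nseq ?sumn_nseq ?n0 ?mul0n //.
- by apply: is_partP => i; rewrite !n0.
- by move=> i; rewrite !n0.
- by move=> i; rewrite !n0.
Qed.

Lemma LRcoef_one_row (x y z : nat) : x + y = z -> 0 < LRcoef [:: x] [:: y] [:: z].
Proof.
move=> Ez; apply: LRcoef_row_right => //=; last by lia.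
- by case=> [|i] /=; lia.
- by case=> [|i] /=; rewrite ?nth_nil; lia.
- by move=> k; rewrite nth_nil.
Qed.

(** Deleting the first row removes the largest possible horizontal strip: the interlacing
    [ga_(i+1) <= al_i] is an equality. *)
Lemma LRcoef_cons_right (x : nat) (s : seq nat) : is_part (x :: s) ->
  0 < LRcoef s [:: x] (x :: s).
Proof.
move=> ps; apply: LRcoef_row_right => //=; last by lia.
- by move=> i; have := is_part_nth ps (leqnSn i).
- by move=> k; rewrite nth_nil.
Qed.

Lemma LRcoef_cons_left (x : nat) (s : seq nat) : is_part (x :: s) ->
  0 < LRcoef [:: x] s (x :: s).
Proof.
move=> ps; apply: LRcoef_row_left => //=; last by lia.
- by move=> i; have := is_part_nth ps (leqnSn i).
- by move=> k; rewrite nth_nil.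
Qed.

Lemma nth_rcons0 (s : seq nat) (i : nat) : nth 0 (rcons s 0) i = nth 0 s i.
Proof.
by rewrite nth_rcons; case: ltngtP => // H; rewrite nth_default // ?H // ltnW.
Qed.

Lemma is_part_rcons0 (s : seq nat) : is_part s -> is_part (rcons s 0).
Proof. by move=> ps; apply: is_partP => i; rewrite !nth_rcons0 is_part_nth. Qed.

Lemma sumn_rcons0 (s : seq nat) : sumn (rcons s 0) = sumn s.
Proof. by rewrite sumn_rcons addn0. Qed.

Lemma LRcoef_rcons0_right (s : seq nat) : is_part s ->
  0 < LRcoef s [:: 0] (rcons s 0).
Proof.
move=> ps; apply: LRcoef_row_right; rewrite ?size_rcons ?is_part_rcons0 //.
- by move=> i; rewrite nth_rcons0.
- by move=> i; rewrite nth_rcons0 is_part_nth.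
- by move=> k; rewrite /= nth_nil.
- by rewrite sumn_rcons0 addn0.
Qed.

Lemma LRcoef_rcons0_left (s : seq nat) : is_part s ->
  0 < LRcoef [:: 0] s (rcons s 0).
Proof.
move=> ps; apply: LRcoef_row_left; rewrite ?size_rcons ?is_part_rcons0 //.
- by move=> i; rewrite nth_rcons0.
- by move=> i; rewrite nth_rcons0 is_part_nth.
- by move=> k; rewrite /= nth_nil.
- by rewrite sumn_rcons0 addn0.
Qed.

Lemma nth_map_predn (s : seq nat) (i : nat) : nth 0 (map predn s) i = (nth 0 s i).-1.
Proof.
by case: (ltnP i (size s)) => H; [rewrite (nth_map 0) | rewrite !nth_default ?size_map].
Qed.

Lemma is_part_map_predn (s : seq nat) : is_part s -> is_part (map predn s).
Proof.
move=> ps; apply: is_partP => i; rewrite !nth_map_predn.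
by have := is_part_nth ps (leqnSn i); lia.
Qed.

Lemma nth_nseq1 (d k : nat) : nth 0 (nseq d 1) k = (k < d).
Proof. by rewrite nth_nseq; case: ltnP. Qed.

(** Dually, deleting the first column, which meets every row as all parts are positive, removes a
    vertical strip of full height. *)
Lemma LRcoef_predn_right (s : seq nat) : is_part s -> all (leq 1) s ->
  0 < LRcoef (map predn s) (nseq (size s) 1) s.
Proof.
move=> ps s1; apply: (@LRcoef_col_right (size s)); rewrite ?size_map ?size_nseq //.
- exact: is_part_map_predn.
- by move=> i; rewrite nth_map_predn; lia.
- by move=> k; rewrite nth_nseq1.
- exact: sumn_map_predn.
Qed.

Lemma LRcoef_predn_left (s : seq nat) : is_part s -> all (leq 1) s ->
  0 < LRcoef (nseq (size s) 1) (map predn s) s.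
Proof.
move=> ps s1; apply: (@LRcoef_col_left (size s)); rewrite ?size_map //.
- exact: is_part_map_predn.
- by move=> i; rewrite nth_map_predn; lia.
- by move=> k; rewrite nth_nseq1.
- exact: sumn_map_predn.
Qed.

Lemma is_part_nseq (d x : nat) : is_part (nseq d x).
Proof. by apply: is_partP => i; rewrite !nth_nseq; do !case: ifP; lia. Qed.

Lemma LRcoef_one_col (x y : nat) :
  0 < LRcoef (nseq x 1) (nseq y 1) (nseq (x + y) 1).
Proof.
apply: (@LRcoef_col_right y); rewrite ?size_nseq ?leq_addr ?sumn_nseq ?is_part_nseq //; last lia.
  by move=> i; rewrite !nth_nseq1; lia.
by move=> k; rewrite nth_nseq1.
Qed.

(** * Inequalities obtained from explicit elements of [G_n] *)

Definition Horn_NL (n : nat) (mu nu la : n.-tuple nat) : Prop :=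
  forall A A' B B' C C' : {set 'I_n}, in_G A A' B B' C C' ->
     (0 <= sum_on A mu - sum_on A' mu + sum_on B nu - sum_on B' nu
           + sum_on C la - sum_on C' la)%R.

(** A cyclic shift permutes the defining coefficients without touching the order of their lower
    arguments; a transposition would reverse that order. *)
Lemma in_G_rot (n : nat) (A A' B B' C C' : {set 'I_n}) :
  in_G A A' B B' C C' -> in_G C C' A A' B B'.
Proof.
case=> -[dA dB dC] [eA eB eC] [A1 [A2 [B1 [B2 [C1 [C2 []]]]]]].
case=> a1 a2 b1 b2 [c1 c2] [q1 q2 q3] [r1 r2 r3].
split; [by split | by split; lia |].
by exists C1, C2, A1, A2, B1, B2.
Qed.

Lemma Horn_NL_rot (n : nat) (mu nu la : n.-tuple nat) :
  Horn_NL mu nu la -> Horn_NL nu la mu.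
Proof. by move=> H A A' B B' C C' /in_G_rot /H; lia. Qed.

Lemma Horn_NL_seq (n : nat) (mu nu la : n.-tuple nat)
    (a a' b b' c c' a1 a2 b1 b2 c1 c2 : seq nat) :
  Horn_NL mu nu la ->
  all (increasing_below n) [:: a; a'; b; b'; c; c'] ->
  all (increasing_below n) [:: a1; a2; b1; b2; c1; c2] ->
  [/\ ~~ has (mem a) a', ~~ has (mem b) b' & ~~ has (mem c) c'] ->
  [/\ size a = size b' + size c', size b = size a' + size c'
    & size c = size a' + size b'] ->
  [/\ size a1 = size a', size a2 = size a', size b1 = size b' & size b2 = size b'] ->
  size c1 = size c' /\ size c2 = size c' ->
  [/\ 0 < LRcoef (seq_tau a1) (seq_tau a2) (seq_tau a'),
      0 < LRcoef (seq_tau b1) (seq_tau b2) (seq_tau b')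
    & 0 < LRcoef (seq_tau c1) (seq_tau c2) (seq_tau c')] ->
  [/\ 0 < LRcoef (seq_tau b1) (seq_tau c2) (seq_tau a),
      0 < LRcoef (seq_tau c1) (seq_tau a2) (seq_tau b)
    & 0 < LRcoef (seq_tau a1) (seq_tau b2) (seq_tau c)] ->
  \sum_(x <- a') nth 0 mu x + \sum_(x <- b') nth 0 nu x + \sum_(x <- c') nth 0 la x
  <= \sum_(x <- a) nth 0 mu x + \sum_(x <- b) nth 0 nu x + \sum_(x <- c) nth 0 la x.
Proof.
move=> H /= /and5P[ia ia' ib ib' /and3P[ic ic' _]].
move=> /and5P[ia1 ia2 ib1 ib2 /and3P[ic1 ic2 _]] [dA dB dC] sz sz1 sz2 LR1 LR2.
have /H : in_G (seq_set n a) (seq_set n a') (seq_set n b) (seq_set n b')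
               (seq_set n c) (seq_set n c').
  split; first by split; exact: seq_set_disjoint.
    by rewrite !card_seq_set.
  exists (seq_set n a1), (seq_set n a2), (seq_set n b1), (seq_set n b2),
    (seq_set n c1), (seq_set n c2).
  by rewrite !card_seq_set // !tau_seq_set.
by rewrite !sum_on_seq_set //; lia.
Qed.

(** The analogue of Weyl's eigenvalue inequalities. All index sets have at most one element, so only
    one-row coefficients occur. Rows use [j = 1], where [la_1 = 0], and columns use [j = 0], where
    [la_0 <= 1]. *)
Lemma Horn_NL_Weyl (n : nat) (mu nu la : n.-tuple nat) (i j : nat) :
  Horn_NL mu nu la -> i + j < n ->
  nth 0 mu (i + j) <= nth 0 nu i + nth 0 la j /\
  nth 0 nu (i + j) <= nth 0 mu i + nth 0 la j.
Proof.
move=> H lt_ij.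
have inc x : x < n -> increasing_below n [:: x] by rewrite /increasing_below /= => ->.
have inc0 : increasing_below n [::] by [].
have lt_i : i < n by lia.
have lt_j : j < n by lia.
have pt x : is_part [:: x] by [].
have p0 : 0 < LRcoef [::] [::] [::] by exact: (@LRcoef_zero_right [::] 0).
have zr x : 0 < LRcoef [:: x] [::] [:: x] by exact: (@LRcoef_zero_right _ 0).
have zl x : 0 < LRcoef [::] [:: x] [:: x] by exact: (@LRcoef_zero_left _ 0).
have c1 : 0 < LRcoef [:: i] [:: j] [:: i + j] by exact: LRcoef_one_row.
have c2 : 0 < LRcoef [:: j] [:: i] [:: i + j] by apply: LRcoef_one_row; lia.
split.
  unshelve epose proof (@Horn_NL_seq _ _ _ _ [::] [:: i + j] [:: i] [::] [:: j] [::]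
    [:: j] [:: i] [::] [::] [::] [::] H _ _ _ _ _ _ _ _) as Q;
    rewrite ?seq_tau1 //=; rewrite ?inc //.
  by move: Q; rewrite !big_seq1 !big_nil; lia.
unshelve epose proof (@Horn_NL_seq _ _ _ _ [:: i] [::] [::] [:: i + j] [:: j] [::]
  [::] [::] [:: i] [:: j] [::] [::] H _ _ _ _ _ _ _ _) as Q;
  rewrite ?seq_tau1 //=; rewrite ?inc //.
by move: Q; rewrite !big_seq1 !big_nil; lia.
Qed.

Lemma sum_ord_iota (n : nat) (F : nat -> nat) :
  \sum_(i < n) F i = \sum_(i <- iota 0 n) F i.
Proof. by rewrite -(big_mkord xpredT) /index_iota subn0. Qed.

Definition dist (x y : nat) : nat := (x - y) + (y - x).

Lemma sum_dist_filter (f g : nat -> nat) (r : seq nat) :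
  \sum_(i <- r) dist (f i) (g i)
    + (\sum_(i <- [seq i <- r | f i <= g i]) f i
       + \sum_(i <- [seq i <- r | ~~ (f i <= g i)]) g i)
  = \sum_(i <- [seq i <- r | ~~ (f i <= g i)]) f i
    + \sum_(i <- [seq i <- r | f i <= g i]) g i.
Proof.
elim: r => [|x r IH] /=; first by rewrite !big_nil.
by case: leqP => Hx /=; rewrite !big_cons; rewrite /dist in IH *; lia.
Qed.

Lemma has_filter_predC (p : pred nat) (r : seq nat) :
  ~~ has (mem [seq i <- r | p i]) [seq i <- r | ~~ p i].
Proof.
by apply/hasPn => x; rewrite mem_filter /= => /andP[H _]; rewrite mem_filter (negbTE H).
Qed.

Lemma size_filter_predC (p : pred nat) (r : seq nat) :
  size [seq i <- r | ~~ p i] + size [seq i <- r | p i] = size r.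
Proof. by rewrite !size_filter addnC count_predC. Qed.

(** At each index the larger of [mu_i], [nu_i] is subtracted and the smaller added, while [C] is all
    of [[n]]. Every coefficient has a zero partition as a lower argument. *)
Lemma Horn_NL_dist (n : nat) (mu nu la : n.-tuple nat) :
  Horn_NL mu nu la ->
  \sum_(i < n) dist (nth 0 mu i) (nth 0 nu i) <= sumn la.
Proof.
move=> H; pose s := [seq i <- iota 0 n | ~~ (nth 0 mu i <= nth 0 nu i)].
pose t := [seq i <- iota 0 n | nth 0 mu i <= nth 0 nu i].
have in0 : increasing_below n (iota 0 n) by apply: increasing_below_iota.
have ins : increasing_below n s by apply: increasing_below_filter.
have int : increasing_below n t by apply: increasing_below_filter.
have inc d : d <= n -> increasing_below n (iota 0 d).
  by move=> le_d; apply: increasing_below_iota.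
have sz : size s + size t = n by rewrite size_filter_predC size_iota.
have ps : is_part (seq_tau s) by apply: is_part_seq_tau; case/andP: ins.
have pt : is_part (seq_tau t) by apply: is_part_seq_tau; case/andP: int.
have tau0 : seq_tau [::] = [::] by [].
unshelve epose proof (@Horn_NL_seq _ _ _ _ t s s t (iota 0 n) [::]
    (iota 0 (size s)) s t (iota 0 (size t)) [::] [::] H _ _ _ _ _ _ _ _) as Q;
  rewrite ?seq_tau_iota ?tau0 ?size_iota //=.
- by rewrite ins int in0.
- by rewrite ins int !inc //; lia.
- split=> //; first exact: has_filter_predC.
  apply/hasPn => x; rewrite mem_filter => /andP[le_x _] /=.
  by rewrite mem_filter le_x.
- by split; lia.
- by split; [exact: LRcoef_zero_left | exact: LRcoef_zero_right | exact: (@LRcoef_zeros 0 0 0)].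
- split; [exact: (@LRcoef_zero_right _ 0) | exact: (@LRcoef_zero_left _ 0) |].
  by apply: LRcoef_zeros; lia.
have := sum_dist_filter (nth 0 mu) (nth 0 nu) (iota 0 n); rewrite -/s -/t.
rewrite (@sumn_nth _ n) ?size_tuple // (sum_ord_iota n (nth 0 la)).
rewrite (sum_ord_iota n (fun i => dist (nth 0 mu i) (nth 0 nu i))).
by move: Q; rewrite !big_nil; lia.
Qed.

(** The same signs are used from index 1 on, whereas index 0 is added for [mu] and [nu] and
    subtracted for [la]. Adjoining 0 to [s] and [t] costs each of their partitions a first column,
    and the two columns recombine into the column that [C] encodes. *)
Lemma Horn_NL_row_bound (n : nat) (mu nu la : n.-tuple nat) :
  0 < n -> Horn_NL mu nu la ->
  nth 0 la 0 + \sum_(1 <= i < n) dist (nth 0 mu i) (nth 0 nu i)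
  <= nth 0 mu 0 + nth 0 nu 0 + \sum_(1 <= i < n) nth 0 la i.
Proof.
move=> n0 H; pose s := [seq i <- iota 1 n.-1 | ~~ (nth 0 mu i <= nth 0 nu i)].
pose t := [seq i <- iota 1 n.-1 | nth 0 mu i <= nth 0 nu i].
have in1 : increasing_below n (iota 1 n.-1) by apply: increasing_below_iota; lia.
have ins : increasing_below n s by apply: increasing_below_filter.
have int : increasing_below n t by apply: increasing_below_filter.
have ge1 (p : pred nat) : all (leq 1) [seq i <- iota 1 n.-1 | p i].
  by apply/allP => x; rewrite mem_filter mem_iota => /andP[_ /andP[]].
have s1 : all (leq 1) s by apply: ge1.
have t1 : all (leq 1) t by apply: ge1.
have inc0 p : increasing_below n p -> all (leq 1) p -> increasing_below n (0 :: p).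
  by move=> ip p1; apply: increasing_below_cons0.
have incp p : increasing_below n p -> all (leq 1) p -> increasing_below n (map predn p).
  by move=> ip p1; apply: increasing_below_predn.
have i0 : increasing_below n [:: 0] by rewrite /increasing_below /= n0.
have sz : size s + size t = n.-1 by rewrite size_filter_predC size_iota.
have inc d : d < n -> increasing_below n (iota 1 d).
  by move=> le_d; apply: increasing_below_iota.
have ps p : increasing_below n p -> is_part (seq_tau p).
  by case/andP=> sp _; apply: is_part_seq_tau.
have pos p : increasing_below n p -> all (leq 1) p -> all (leq 1) (seq_tau p).
  by case/andP=> sp _; apply: seq_tau_gt0.
unshelve epose proof (@Horn_NL_seq _ _ _ _ (0 :: t) s (0 :: s) t (iota 1 n.-1) [:: 0]
    (iota 1 (size s)) (map predn s) (map predn t) (iota 1 (size t)) [:: 0] [:: 0]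
    H _ _ _ _ _ _ _ _) as Q;
  rewrite ?seq_tau_iota ?seq_tau1 ?seq_tau_cons0 ?seq_tau_map_predn ?size_map ?size_iota.
- by rewrite /= ins int in1 i0 !inc0 ?ins ?int.
- by rewrite /= !incp // i0 !inc //; lia.
- split.
  + apply/hasPn => x; rewrite mem_filter mem_iota => /andP[le_x /andP[x1 _]] /=.
    by rewrite inE mem_filter (negbTE le_x) andFb orbF; lia.
  + apply/hasPn => x; rewrite mem_filter mem_iota => /andP[le_x /andP[x1 _]] /=.
    by rewrite inE mem_filter le_x andFb orbF; lia.
  + by apply/hasPn => x; rewrite inE => /eqP -> /=; rewrite mem_iota.
- by split=> /=; lia.
- by [].
- by [].
- split; last exact: LRcoef_one_row.
  + by rewrite -(size_seq_tau s); apply: LRcoef_predn_left; auto.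
  + by rewrite -(size_seq_tau t); apply: LRcoef_predn_right; auto.
- split.
  + by apply: LRcoef_rcons0_right; rewrite -seq_tau_map_predn; auto.
  + by apply: LRcoef_rcons0_left; rewrite -seq_tau_map_predn; auto.
  + by rewrite -sz; exact: LRcoef_one_col.
have := sum_dist_filter (nth 0 mu) (nth 0 nu) (iota 1 n.-1); rewrite -/s -/t.
rewrite /index_iota subn1; move: Q; rewrite !big_cons !big_nil; lia.
Qed.

(* When [la] is a column, [mu] and [nu] have at most [m] parts and differ by at
   most 1 in each place, this forces [la] to vanish at position [2 m - d], hence
   bounds its height by [2 m - d]. *)
Lemma Horn_NL_col_bound (n m : nat) (mu nu la : n.-tuple nat)
    (s := [seq i <- iota 0 m | nth 0 nu i < nth 0 mu i])
    (t := [seq i <- iota 0 m | nth 0 mu i < nth 0 nu i])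
    (d := size s + size t) :
  Horn_NL mu nu la -> m < n -> 2 * m - d < n ->
  \sum_(x <- s) nth 0 mu x + \sum_(x <- t) nth 0 nu x + nth 0 la (2 * m - d)
  <= \sum_(x <- t) nth 0 mu x + nth 0 mu m + (\sum_(x <- s) nth 0 nu x + nth 0 nu m)
     + \sum_(i < d) nth 0 la i.
Proof.
move=> H lt_m lt_d.
have inm : increasing_below m (iota 0 m) by apply: increasing_below_iota.
have ins : increasing_below m s by apply: increasing_below_filter.
have int : increasing_below m t by apply: increasing_below_filter.
have incn p : increasing_below m p -> increasing_below n p.
  by case/andP=> sp /allP lt_p; rewrite /increasing_below sp; apply/allP => x /lt_p; lia.
have incr p : increasing_below m p -> increasing_below n (rcons p m).
  exact: increasing_below_rcons.
have le_d : d <= m.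
  rewrite /d !size_filter -[X in _ <= X](size_iota 0) -count_predUI.
  rewrite [X in _ + X](@eq_count _ _ pred0) ?count_pred0 ?addn0 ?count_size //.
  by move=> x /=; lia.
have [sm tm] : size s <= m /\ size t <= m by rewrite /d in le_d; lia.
have inc k : k <= n -> increasing_below n (iota 0 k).
  by move=> le_k; apply: increasing_below_iota.
have inc1 x : x < n -> increasing_below n [:: x] by rewrite /increasing_below /= => ->.
have ps p : increasing_below n p -> is_part (seq_tau p).
  by case/andP=> sp _; apply: is_part_seq_tau.
have notin p : increasing_below m p -> m \notin p.
  by case/andP=> _ /allP lt_p; apply/negP => /lt_p; rewrite ltnn.
(* Adjoining [m] to [t] and [s] creates the new first parts [m - size t] and [m - size s]. These are
   the one-row partitions of [c2] and [c1], and their sum [2 * m - d] is the element of [C']. *)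
unshelve epose proof (@Horn_NL_seq _ _ _ _ (rcons t m) s (rcons s m) t (iota 0 d) [:: 2 * m - d]
    (iota 0 (size s)) s t (iota 0 (size t)) [:: m - size s] [:: m - size t]
    H _ _ _ _ _ _ _ _) as Q;
  rewrite ?seq_tau_iota ?seq_tau1 ?size_rcons ?size_iota ?addn1 //.
- by rewrite /= (incr _ ins) (incr _ int) (incn _ ins) (incn _ int) inc1 // inc //; lia.
- by rewrite /= (incn _ ins) (incn _ int) !inc1 ?inc //; lia.
- split.
  + apply/hasPn => x x_s /=; rewrite mem_rcons inE negb_or.
    have -> : x != m by apply: contraNneq (notin _ ins) => <-.
    by move: x_s; rewrite !mem_filter; lia.
  + apply/hasPn => x x_s /=; rewrite mem_rcons inE negb_or.
    have -> : x != m by apply: contraNneq (notin _ int) => <-.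
    by move: x_s; rewrite !mem_filter; lia.
  + apply/hasPn => x; rewrite inE => /eqP -> /=; rewrite mem_iota; lia.
- split; [by apply: LRcoef_zero_left; auto | by apply: LRcoef_zero_right; auto|].
  by apply: LRcoef_one_row; rewrite /d; lia.
- split.
  + by have := ps _ (incr _ int); rewrite seq_tau_rcons; apply: LRcoef_cons_right.
  + by have := ps _ (incr _ ins); rewrite seq_tau_rcons; apply: LRcoef_cons_left.
  + by apply: LRcoef_zeros; rewrite /d leq_addr.
rewrite (sum_ord_iota d (nth 0 la)).
by move: Q; rewrite -!cats1 !big_cat !big_seq1 /=; lia.
Qed.

(** * Construction of the triple when [la] is a row or a column *)

(** Both orders are recorded because undoing a cyclic shift changes which of the three partitions
    comes first. *)
Definition LR_both (al be ga : seq nat) : Prop :=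
  0 < LRcoef al be ga /\ 0 < LRcoef be al ga.

Definition NL_witness (n : nat) (mu nu la : seq nat) : Prop :=
  exists X Y Z : seq nat,
    [/\ [/\ size X = n, size Y = n & size Z = n],
        [/\ is_part X, is_part Y & is_part Z]
      & [/\ LR_both X Y mu, LR_both X Z nu & LR_both Y Z la]].

Definition row_part (n p : nat) : seq nat := p :: nseq n.-1 0.

Definition col_part (n k : nat) : seq nat := nseq k 1 ++ nseq (n - k) 0.

Lemma nth_row_part0 (n p : nat) : nth 0 (row_part n p) 0 = p.
Proof. by []. Qed.

Lemma nth_row_partS (n p k : nat) : nth 0 (row_part n p) k.+1 = 0.
Proof. by rewrite /= nth_nseq if_same. Qed.

Lemma size_row_part (n p : nat) : 0 < n -> size (row_part n p) = n.
Proof. by move=> n0; rewrite /= size_nseq prednK. Qed.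

Lemma is_part_row_part (n p : nat) : is_part (row_part n p).
Proof. by apply: is_partP => i; rewrite nth_row_partS. Qed.

Lemma sumn_row_part (n p : nat) : sumn (row_part n p) = p.
Proof. by rewrite /= sumn_nseq mul0n addn0. Qed.

Lemma nth_col_part (n k i : nat) : nth 0 (col_part n k) i = (i < k).
Proof.
by rewrite nth_cat size_nseq !nth_nseq; case: ltnP => // _; rewrite if_same.
Qed.

Lemma size_col_part (n k : nat) : k <= n -> size (col_part n k) = n.
Proof. by move=> le_k; rewrite size_cat !size_nseq subnKC. Qed.

Lemma is_part_col_part (n k : nat) : is_part (col_part n k).
Proof. by apply: is_partP => i; rewrite !nth_col_part; lia. Qed.

Lemma sumn_col_part (n k : nat) : sumn (col_part n k) = k.
Proof. by rewrite sumn_cat !sumn_nseq mul0n mul1n addn0. Qed.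

Lemma LR_both_row (n b : nat) (al ga : seq nat) : 0 < n ->
  is_part ga -> size al = size ga ->
  (forall i, nth 0 al i <= nth 0 ga i) ->
  (forall i, nth 0 ga i.+1 <= nth 0 al i) ->
  sumn al + b = sumn ga -> LR_both al (row_part n b) ga.
Proof.
move=> n0 pga sz le1 le2 Es; split.
  by apply: LRcoef_row_right; rewrite ?sz // => k; rewrite nth_row_partS.
by apply: LRcoef_row_left; rewrite ?sz // => k; rewrite nth_row_partS.
Qed.

Lemma LR_both_col (n b : nat) (al ga : seq nat) : b <= n ->
  is_part al -> is_part ga -> size al = size ga ->
  (forall i, nth 0 al i <= nth 0 ga i <= (nth 0 al i).+1) ->
  sumn al + b = sumn ga -> LR_both al (col_part n b) ga.
Proof.
move=> le_b pal pga sz le1 Es; split.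
  apply: (@LRcoef_col_right b); rewrite ?sz ?size_col_part // => k.
  by rewrite nth_col_part.
by apply: (@LRcoef_col_left b) => // k; rewrite nth_col_part.
Qed.

Lemma sum_maxn_dist (f g : nat -> nat) (m : nat) :
  2 * \sum_(i < m) maxn (f i) (g i)
  = \sum_(i < m) f i + \sum_(i < m) g i + \sum_(i < m) dist (f i) (g i).
Proof.
elim: m => [|m IH]; first by rewrite !big_ord0.
have E : 2 * maxn (f m) (g m) = f m + g m + dist (f m) (g m) by rewrite /dist; lia.
by rewrite !big_ord_recr mulnDr IH E /=; lia.
Qed.

(** The shift loses index 0 and gains the zero values at [n]; hence the terms [f 0], [g 0] and the
    distance sum starting at 1. *)
Lemma sum_maxn_shift (f g : nat -> nat) (n : nat) : 0 < n -> f n = 0 -> g n = 0 ->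
  2 * \sum_(i < n) maxn (f i.+1) (g i.+1) + f 0 + g 0
  = \sum_(i < n) f i + \sum_(i < n) g i + \sum_(1 <= i < n) dist (f i) (g i).
Proof.
case: n => // n _ fn gn; rewrite big_ord_recr fn gn /= addn0.
have := sum_maxn_dist (f \o succn) (g \o succn) n => /= ->.
rewrite big_add1 /= big_mkord !big_ord_recl /bump /=.
by rewrite [RHS]addn.[AC (2*2*1) (2*4*5*1*3)].
Qed.

Lemma sum_minn_dist (f g : nat -> nat) (m : nat) :
  2 * \sum_(i < m) minn (f i) (g i) + \sum_(i < m) dist (f i) (g i)
  = \sum_(i < m) f i + \sum_(i < m) g i.
Proof.
elim: m => [|m IH]; first by rewrite !big_ord0.
have E : 2 * minn (f m) (g m) + dist (f m) (g m) = f m + g m by rewrite /dist; lia.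
by rewrite !big_ord_recr mulnDr addnACA IH E addnACA.
Qed.

Lemma mkseq_part (n : nat) (x : nat -> nat) : (forall i, x i.+1 <= x i) ->
  (forall i, n <= i -> x i = 0) ->
  [/\ is_part (mkseq x n), forall i, nth 0 (mkseq x n) i = x i
    & sumn (mkseq x n) = \sum_(i < n) x i].
Proof.
move=> x_dec x0.
have nthE i : nth 0 (mkseq x n) i = x i.
  case: (ltnP i n) => [lt_i|le_i]; first by rewrite nth_mkseq.
  by rewrite nth_default ?size_mkseq ?x0.
split=> //; first by apply: is_partP => i; rewrite !nthE.
by rewrite (@sumn_nth _ n) ?size_mkseq //; apply: eq_bigr.
Qed.

Lemma NL_witness_row (n p : nat) (mu nu la : n.-tuple nat) : 0 < n ->
  is_part mu -> is_part nu -> ~~ odd (sumn mu + sumn nu + sumn la) ->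
  Horn_NL mu nu la -> la = row_part n p :> seq nat -> NL_witness n mu nu la.
Proof.
move=> n0 pmu pnu ev H Ela.
have interlace i : nth 0 mu i.+1 <= nth 0 nu i /\ nth 0 nu i.+1 <= nth 0 mu i.
  case: (ltnP i.+1 n) => [lt_i|le_i]; last first.
    by have z (s : n.-tuple nat) : nth 0 s i.+1 = 0; rewrite ?z // nth_default ?size_tuple.
  rewrite -addn1 in lt_i; have := Horn_NL_Weyl H lt_i.
  by rewrite Ela nth_row_partS addn1 !addn0.
have dec_mu i : nth 0 mu i.+1 <= nth 0 mu i by apply: is_part_nth.
have dec_nu i : nth 0 nu i.+1 <= nth 0 nu i by apply: is_part_nth.
have H2 := Horn_NL_dist H; have H3 := Horn_NL_row_bound n0 H.
have sla : sumn la = p by rewrite Ela sumn_row_part.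
have tail0 : \sum_(1 <= i < n) nth 0 la i = 0.
  by rewrite big_nat big1 // => -[|i] // _; rewrite Ela nth_row_partS.
rewrite tail0 Ela nth_row_part0 addn0 in H3; rewrite sla in H2 ev.
(* The strip conditions are [mu_(i+1) <= x_i <= mu_i], and the same for [nu]. *)
pose lo i := maxn (nth 0 mu i.+1) (nth 0 nu i.+1).
pose hi i := minn (nth 0 mu i) (nth 0 nu i).
have smu : sumn mu = \sum_(i < n) nth 0 mu i by apply: sumn_nth; rewrite size_tuple.
have snu : sumn nu = \sum_(i < n) nth 0 nu i by apply: sumn_nth; rewrite size_tuple.
have hiE := sum_minn_dist (nth 0 mu) (nth 0 nu) n.
have loE : 2 * \sum_(i < n) lo i + nth 0 mu 0 + nth 0 nu 0
    = sumn mu + sumn nu + \sum_(1 <= i < n) dist (nth 0 mu i) (nth 0 nu i).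
  rewrite smu snu; apply: (sum_maxn_shift n0 (f := nth 0 mu) (g := nth 0 nu));
    by rewrite nth_default ?size_tuple.
pose s := (sumn mu + sumn nu - p)./2.
(* The difference in [s] is not truncated: [H3] and [loE] bound [p] by [|mu| + |nu|]. Then [H3] is
   the bound [|lo| <= s] and [H2] the bound [s <= |hi|]. *)
have sE : 2 * s + p = sumn mu + sumn nu by move: ev; rewrite /s; lia.
have [|||||x [x_bnd x_dec xs]] := @interpolate_part n s lo hi.
- by move=> i; rewrite /lo /hi; have := interlace i; have := dec_mu i; have := dec_nu i; lia.
- by move=> i; rewrite /lo; have := dec_mu i.+1; have := dec_nu i.+1; lia.
- by move=> i; rewrite /hi; have := dec_mu i; have := dec_nu i; lia.
- lia.
- by move: hiE; rewrite /hi -smu -snu; lia.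
have [|pX nthX sX] := mkseq_part (n := n) x_dec.
  move=> i le_i; have := x_bnd i; rewrite /hi !nth_default ?size_tuple //; lia.
have szX : size (mkseq x n) = n by rewrite size_mkseq.
have le_mu : sumn (mkseq x n) <= sumn mu.
  by rewrite sX smu; apply: leq_sum => i _; have := x_bnd i; rewrite /hi; lia.
have le_nu : sumn (mkseq x n) <= sumn nu.
  by rewrite sX snu; apply: leq_sum => i _; have := x_bnd i; rewrite /hi; lia.
rewrite xs in sX; rewrite sX in le_mu le_nu.
exists (mkseq x n), (row_part n (sumn mu - s)), (row_part n (sumn nu - s)).
split; [by rewrite !size_row_part | by rewrite !is_part_row_part | split].
- apply: LR_both_row => //; rewrite ?size_mkseq ?size_tuple ?sX ?subnKC // => i.
    by rewrite nthX; have := x_bnd i; rewrite /hi; lia.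
  by rewrite nthX; have := x_bnd i; rewrite /lo; lia.
- apply: LR_both_row => //; rewrite ?size_mkseq ?size_tuple ?sX ?subnKC // => i.
    by rewrite nthX; have := x_bnd i; rewrite /hi; lia.
  by rewrite nthX; have := x_bnd i; rewrite /lo; lia.
rewrite Ela; apply: LR_both_row; rewrite ?is_part_row_part ?size_row_part ?sumn_row_part //.
- by case=> [|i]; rewrite ?nth_row_partS ?nth_row_part0 //; lia.
- by move=> i; rewrite nth_row_partS.
- by lia.
Qed.

Lemma sum_filter_dist1 (f g : nat -> nat) (r : seq nat)
    (s := [seq i <- r | g i < f i]) (t := [seq i <- r | f i < g i]) :
  (forall i, dist (f i) (g i) <= 1) ->
  size s + size t = \sum_(i <- r) dist (f i) (g i) /\
  \sum_(x <- s) f x + \sum_(x <- t) g x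
  = \sum_(x <- t) f x + \sum_(x <- s) g x + \sum_(i <- r) dist (f i) (g i).
Proof.
move=> d1; rewrite /s /t; elim: r {s t} => [|x r [IH1 IH2]] /=; first by rewrite !big_nil.
have := d1 x; rewrite !big_cons -IH1; rewrite -IH1 in IH2; rewrite /dist.
by case: ltngtP => Hx /=; rewrite ?big_cons /=; lia.
Qed.

Lemma NL_witness_col (n k : nat) (mu nu la : n.-tuple nat) : k <= n ->
  is_part mu -> is_part nu -> ~~ odd (sumn mu + sumn nu + sumn la) ->
  Horn_NL mu nu la -> la = col_part n k :> seq nat -> NL_witness n mu nu la.
Proof.
move=> le_kn pmu pnu ev H Ela.
have laE i : nth 0 la i = (i < k) by rewrite Ela nth_col_part.
have d1 i : dist (nth 0 mu i) (nth 0 nu i) <= 1.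
  case: (ltnP i n) => [lt_i|le_i]; last by rewrite !nth_default ?size_tuple.
  rewrite -[i]addn0 in lt_i; have := Horn_NL_Weyl H lt_i.
  by rewrite laE addn0 /dist; lia.
have dec_mu i : nth 0 mu i.+1 <= nth 0 mu i by apply: is_part_nth.
have dec_nu i : nth 0 nu i.+1 <= nth 0 nu i by apply: is_part_nth.
have H2 := Horn_NL_dist H.
have sla : sumn la = k by rewrite Ela sumn_col_part.
rewrite sla in H2 ev.
have smu : sumn mu = \sum_(i < n) nth 0 mu i by apply: sumn_nth; rewrite size_tuple.
have snu : sumn nu = \sum_(i < n) nth 0 nu i by apply: sumn_nth; rewrite size_tuple.
(* The larger of the lengths of [mu] and [nu]; [find] returns [n] when no row vanishes in both. *)
pose m := find (fun i => (nth 0 mu i == 0) && (nth 0 nu i == 0)) (iota 0 n).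
have le_m : m <= n by rewrite -[X in _ <= X](size_iota 0) find_size.
have m_pos i : i < m -> 0 < maxn (nth 0 mu i) (nth 0 nu i).
  move=> lt_i; have := before_find 0 lt_i.
  by rewrite nth_iota ?add0n; lia.
have m_zero i : m <= i -> nth 0 mu i = 0 /\ nth 0 nu i = 0.
  move=> le_i; case: (ltnP m n) => [lt_m|ge_m]; last first.
    by rewrite !nth_default ?size_tuple // (leq_trans ge_m).
  have hs : has (fun i => (nth 0 mu i == 0) && (nth 0 nu i == 0)) (iota 0 n).
    by rewrite has_find size_iota.
  have := nth_find 0 hs; rewrite -/m nth_iota // add0n => /andP[/eqP mu0 /eqP nu0].
  by have := is_part_nth pmu le_i; have := is_part_nth pnu le_i; lia.
pose d := \sum_(i <- iota 0 m) dist (nth 0 mu i) (nth 0 nu i).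
have dE : \sum_(i < n) dist (nth 0 mu i) (nth 0 nu i) = d.
  rewrite (sum_ord_iota n (fun i => dist (nth 0 mu i) (nth 0 nu i))).
  have -> : iota 0 n = iota 0 m ++ iota (0 + m) (n - m) by rewrite -iotaD subnKC.
  rewrite big_cat /= -/d [X in _ + X]big1_seq ?addn0 // => i.
  by rewrite mem_iota add0n => /andP[_ /andP[/m_zero[-> ->] _]].
have le_dm : d <= m.
  rewrite /d -(sum_ord_iota m (fun i => dist (nth 0 mu i) (nth 0 nu i))).
  by rewrite -[X in _ <= X]card_ord -sum1_card; apply: leq_sum.
(* Equivalent to [|lo| <= s] below. Otherwise [2 * m - d] is an index where [la] is 1; the rows [m]
   of [mu] and [nu] vanish, and the column bound reads [d + 1 <= d] once the common sums cancel. *)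
have H3 : k + d <= 2 * m.
  rewrite leqNgt; apply/negP => lt_k.
  have lt_d : 2 * m - d < n by lia.
  have lt_m : m < n by lia.
  have le_la : \sum_(i < d) nth 0 la i <= d.
    rewrite -[X in _ <= X]card_ord -sum1_card; apply: leq_sum => i _.
    by rewrite laE; lia.
  have [E1 E2] := sum_filter_dist1 (iota 0 m) d1.
  have := @Horn_NL_col_bound n m mu nu la H lt_m; rewrite /= E1 -/d => /(_ lt_d).
  rewrite E2 -/d laE; have [-> ->] := m_zero m (leqnn m).
  by move/leq_trans/(_ (leq_add (leqnn _) le_la)); lia.
(* The strip conditions are [mu_i - 1 <= x_i <= mu_i], and the same for [nu]. The predecessor of 0
   is 0, so [lo] loses a unit only in the first [m] rows. *)
pose lo i := (maxn (nth 0 mu i) (nth 0 nu i)).-1.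
pose hi i := minn (nth 0 mu i) (nth 0 nu i).
have hiE := sum_minn_dist (nth 0 mu) (nth 0 nu) n.
have maxE := sum_maxn_dist (nth 0 mu) (nth 0 nu) n.
have loE : \sum_(i < n) lo i + m = \sum_(i < n) maxn (nth 0 mu i) (nth 0 nu i).
  rewrite -[X in _ + X](subn0 m) -(sum_ord_between 0 le_m) -big_split.
  apply: eq_bigr => i _ /=; rewrite /lo; case: (ltnP i m) => [/m_pos|/m_zero[-> ->]] //; lia.
rewrite dE -smu -snu in hiE maxE.
pose s := (sumn mu + sumn nu - k)./2.
have sE : 2 * s + k = sumn mu + sumn nu by move: ev; rewrite /s; lia.
have [|||||x [x_bnd x_dec xs]] := @interpolate_part n s lo hi.
- by move=> i; have := d1 i; rewrite /lo /hi /dist; lia.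
- by move=> i; rewrite /lo; have := dec_mu i; have := dec_nu i; lia.
- by move=> i; rewrite /hi; have := dec_mu i; have := dec_nu i; lia.
- lia.
- by move: hiE; rewrite dE in H2; rewrite /hi; lia.
have [|pX nthX sX] := mkseq_part (n := n) x_dec.
  move=> i le_i; have := x_bnd i; rewrite /hi !nth_default ?size_tuple //; lia.
have szX : size (mkseq x n) = n by rewrite size_mkseq.
have le_mu : sumn (mkseq x n) <= sumn mu.
  by rewrite sX smu; apply: leq_sum => i _; have := x_bnd i; rewrite /hi; lia.
have le_nu : sumn (mkseq x n) <= sumn nu.
  by rewrite sX snu; apply: leq_sum => i _; have := x_bnd i; rewrite /hi; lia.
rewrite xs in sX; rewrite sX in le_mu le_nu.
exists (mkseq x n), (col_part n (sumn mu - s)), (col_part n (sumn nu - s)).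
split; [by rewrite !size_col_part //; lia | by rewrite !is_part_col_part | split].
- apply: LR_both_col => //; rewrite ?size_mkseq ?size_tuple ?sX ?subnKC //; first lia.
  by move=> i; rewrite nthX; have := x_bnd i; rewrite /hi /lo; lia.
- apply: LR_both_col => //; rewrite ?size_mkseq ?size_tuple ?sX ?subnKC //; first lia.
  by move=> i; rewrite nthX; have := x_bnd i; rewrite /hi /lo; lia.
rewrite Ela; apply: LR_both_col; rewrite ?is_part_col_part ?size_col_part ?sumn_col_part //;
  try lia.
by move=> i; rewrite !nth_col_part; lia.
Qed.

Lemma NL_witness_special (n : nat) (mu nu la : n.-tuple nat) : 0 < n ->
  is_part mu -> is_part nu -> ~~ odd (sumn mu + sumn nu + sumn la) ->
  Horn_NL mu nu la -> single_row la \/ single_column la -> NL_witness n mu nu la.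
Proof.
move=> n0 pmu pnu ev H [[p Ela]|[k le_k Ela]].
  exact: (NL_witness_row n0 pmu pnu ev H Ela).
exact: (NL_witness_col le_k pmu pnu ev H Ela).
Qed.

Theorem theorem1p5 (n : nat) (mu nu la : n.-tuple nat) :
  0 < n ->
  is_part mu -> is_part nu -> is_part la ->
  ~~ odd (sumn mu + sumn nu + sumn la) ->
  (forall A A' B B' C C' : {set 'I_n}, in_G A A' B B' C C' ->
     (0 <= sum_on A mu - sum_on A' mu + sum_on B nu - sum_on B' nu
           + sum_on C la - sum_on C' la)%R) ->
  [\/ single_row mu \/ single_column mu,
      single_row nu \/ single_column nu
    | single_row la \/ single_column la] ->
  0 < NL mu nu la.
Proof.
move=> n0 pmu pnu pla ev H; have H1 := Horn_NL_rot H; have H2 := Horn_NL_rot H1.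
have NLpos al be ga := @NL_gt0 mu nu la al be ga pmu pnu.
rewrite !size_tuple in NLpos.
case=> special.
(* In the shifted triple [X] is the partition shared by [nu] and [la], so it takes the place of
   [ga]; in the next case it is shared by [la] and [mu] and takes the place of [be]. *)
- have ev1 : ~~ odd (sumn nu + sumn la + sumn mu) by rewrite addnC addnA.
  have [X [Y [Z [[sX sY sZ] [pX pY pZ] [[_ cY] [_ cZ] [cYZ _]]]]]] :=
    NL_witness_special n0 pnu pla ev1 H1 special.
  exact: (NLpos Y Z X).
- have ev2 : ~~ odd (sumn la + sumn mu + sumn nu) by rewrite -addnA addnC.
  have [X [Y [Z [[sX sY sZ] [pX pY pZ] [[cY _] [_ cZ] [_ cZY]]]]]] :=
    NL_witness_special n0 pla pmu ev2 H2 special.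
  exact: (NLpos Z X Y).
- have [X [Y [Z [[sX sY sZ] [pX pY pZ] [[cY _] [cZ _] [cYZ _]]]]]] :=
    NL_witness_special n0 pmu pnu ev H special.
  exact: (NLpos X Y Z).
Qed.
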